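(* Let $F$ be a field with a nontrivial valuation $v$ and valuation domain $O_v$. Let $R$ be a torsion-free $O_v$-algebra. Then $R$ satisfies GGD (generalized going down) over $O_v$. If in addition $(R^{\times}\cap O_v)\subseteq O_v^{\times}$, then for every chain in $\operatorname{Spec}(O_v)$ there exists a chain in $\operatorname{Spec}(R)$ covering it.
   Context: $O_v=\{x\in F: v(x)\ge0\}$. Rings are associative with $1$, not necessarily commutative; $\operatorname{Spec}(R)$ is the set of prime (two-sided) ideals; chains are with respect to inclusion (of arbitrary cardinality). An $O_v$-algebra is a ring $R$ with a unitary ring homomorphism $O_v\to Z(R)$, $c\mapsto c\cdot 1_R$; it is torsion-free if $cr=0$ with $c\in O_v$, $r\in R$ implies $c=0$ or $r=0$. $R^\times\cap O_v=\{c\in O_v: c\cdot 1_R\in R^\times\}$. An ideal $Q$ of $R$ is lying over $P$ if $P=\{c\in O_v: c\cdot 1_R\in Q\}$. A chain $\mathcal C$ of prime ideals of $R$ covers a chain $\mathcal D$ of prime ideals of $O_v$ if for every $P\in\mathcal D$ there exists $Q\in\mathcal C$ lying over $P$. $R$ satisfies GGD over $O_v$ if for every chain $\mathcal D$ of prime ideals of $O_v$ with a final (largest) element $P_0$ and every prime ideal $Q_0$ of $R$ lying over $P_0$, there exists a chain $\mathcal C$ of prime ideals of $R$ covering $\mathcal D$ whose final element is $Q_0$. *)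

(* Defs.v *)
From HB Require Import structures.
From mathcomp Require Import all_boot all_order all_algebra.
From mathcomp Require Import classical_sets.
Set Implicit Arguments.
Unset Strict Implicit.
Unset Printing Implicit Defensive.
Import Order.TTheory GRing.Theory Num.Theory.
Local Open Scope ring_scope.
Local Open Scope classical_set_scope.

Structure orderedGroupType := OrderedGroupType {
  ogroup_sort :> porderZmodType;
  ogroup_total : total (<=%R : rel ogroup_sort);
  ogroup_leD2l : forall z x y : ogroup_sort, x <= y -> z + x <= z + y
}.

(* The extended group G \cup {oo} is [option G], with [None] as oo. *)
Section Infinity.
Variable G : orderedGroupType.

Definition inf_le (a b : option G) : bool :=
  match a, b with
  | _, None => true
  | None, Some _ => false
  | Some x, Some y => x <= y
  end.

Definition inf_add (a b : option G) : option G :=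
  match a, b with
  | Some x, Some y => Some (x + y)
  | _, _ => None
  end.

Definition inf_min (a b : option G) : option G := if inf_le a b then a else b.

End Infinity.

Record valuation (F : fieldType) (G : orderedGroupType) := Valuation {
  valuation_fun :> F -> option G;
  valuation_oo : forall x, valuation_fun x = None <-> x = 0;
  valuationM : forall x y,
    valuation_fun (x * y) = inf_add (valuation_fun x) (valuation_fun y);
  valuationD : forall x y,
    inf_le (inf_min (valuation_fun x) (valuation_fun y)) (valuation_fun (x + y))
}.

Definition nontrivial_valuation (F : fieldType) (G : orderedGroupType)
    (v : valuation F G) : Prop :=
  exists x : F, x <> 0 /\ v x <> Some 0.

Section ValuationRing.
Variables (F : fieldType) (G : orderedGroupType) (v : valuation F G).

Definition in_valring : {pred F} := fun x => inf_le (Some 0) (v x).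

Lemma ogroup_addr_ge0 (x y : G) : 0 <= x -> 0 <= y -> 0 <= x + y.
Proof.
by move=> x0 y0; apply: le_trans x0 _; rewrite -{1}[x]addr0 ogroup_leD2l.
Qed.

Lemma ogroup_double0 (x : G) : x + x = 0 -> x = 0.
Proof.
move=> xx; apply/eqP; rewrite eq_le.
case/orP: (ogroup_total 0 x) => x0; rewrite x0 ?andbT /=.
  by have := ogroup_leD2l x x0; rewrite xx addr0.
by have := ogroup_leD2l x x0; rewrite xx addr0.
Qed.

Lemma valuation1 : v 1 = Some 0.
Proof.
have := valuationM v 1 1; rewrite mulr1.
case E: (v 1) => [g|] /=; last first.
  by have /eqP := (valuation_oo v 1).1 E; rewrite oner_eq0.
by case=> /eqP; rewrite -{1}[g]addr0 (inj_eq (addrI g)) => /eqP <-.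
Qed.

Lemma valuationN1 : v (-1) = Some 0.
Proof.
have := valuationM v (-1) (-1); rewrite mulrNN mulr1 valuation1.
by case: (v (-1)) => [g|] //= [] /esym /ogroup_double0 ->.
Qed.

Lemma in_valring_subring : subring_closed in_valring.
Proof.
have ringM : {in in_valring &, forall x y, x * y \in in_valring}.
  move=> x y; rewrite !unfold_in /in_valring (valuationM v x y).
  case: (v x) (v y) => [a|] [b|] //=; exact: ogroup_addr_ge0.
split=> //; first by rewrite unfold_in /in_valring valuation1 /=.
move=> x y xV yV.
have {yV}: - y \in in_valring.
  by rewrite -mulN1r; apply: ringM; rewrite // unfold_in /in_valring valuationN1 /=.
move: xV; rewrite !unfold_in /in_valring; have := valuationD v x (- y); rewrite /inf_min.
case: (v x) (v (- y)) (v (x - y)) => [a|] [b|] [c|] //=.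
- case: ifP => _ /= ac a0 b0; [exact: le_trans a0 ac | exact: le_trans b0 ac].
- by move=> ac a0 _; exact: le_trans a0 ac.
- by move=> bc _ b0; exact: le_trans b0 bc.
Qed.

HB.instance Definition _ :=
  GRing.isSubringClosed.Build F in_valring in_valring_subring.

Record valring := Valring { valring_val : F; _ : valring_val \in in_valring }.
HB.instance Definition _ := [isSub for valring_val].
HB.instance Definition _ := [Choice of valring by <:].
HB.instance Definition _ := [SubChoice_isSubComNzRing of valring by <:].

End ValuationRing.

Section PrimeIdeals.
Variable R : pzRingType.

Definition units : set R := [set x | exists y, x * y = 1 /\ y * x = 1].

Record two_sided_ideal (I : set R) : Prop := TwoSidedIdeal {
  ideal0 : I 0;
  idealB : forall x y, I x -> I y -> I (x - y);
  idealMl : forall r x, I x -> I (r * x);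
  idealMr : forall r x, I x -> I (x * r)
}.

(* P is proper and, for ideals I and J, IJ \subseteq P implies I \subseteq P or
   J \subseteq P; containment of IJ is stated on its generating products. *)
Definition prime_ideal (P : set R) : Prop :=
  [/\ two_sided_ideal P, P <> setT &
      forall I J : set R, two_sided_ideal I -> two_sided_ideal J ->
        (forall x y, I x -> J y -> P (x * y)) -> I `<=` P \/ J `<=` P].

Definition Spec : set (set R) := [set P | prime_ideal P].

Definition chain (C : set (set R)) : Prop :=
  forall P Q, C P -> C Q -> P `<=` Q \/ Q `<=` P.

Definition prime_chain (C : set (set R)) : Prop := C `<=` Spec /\ chain C.

Definition final_element (C : set (set R)) (P : set R) : Prop :=
  C P /\ forall Q, C Q -> Q `<=` P.

End PrimeIdeals.

Arguments units : clear implicits.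
Arguments Spec : clear implicits.

(* An A-algebra is a ring R with a unitary ring morphism phi : A -> R that has
   central image. The algType of the library is not used because it excludes
   the zero ring. *)
Section Algebra.
Variables (A : comPzRingType) (R : pzRingType) (phi : {rmorphism A -> R}).

Definition central_morphism : Prop := forall c r, GRing.comm (phi c) r.

Definition torsion_free : Prop :=
  forall (c : A) (r : R), phi c * r = 0 -> c = 0 \/ r = 0.

Definition lying_over (Q : set R) (P : set A) : Prop := P = phi @^-1` Q.

Definition covers (C : set (set R)) (D : set (set A)) : Prop :=
  forall P, D P -> exists2 Q, C Q & lying_over Q P.

Definition GGD : Prop :=
  forall (D : set (set A)) (P0 : set A) (Q0 : set R),
    prime_chain D -> final_element D P0 ->
    Spec R Q0 -> lying_over Q0 P0 ->
    exists C : set (set R),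
      [/\ prime_chain C, covers C D & final_element C Q0].

End Algebra.

(* Main.v *)
From mathcomp Require Import all_boot all_order all_algebra.
From mathcomp Require Import boolp classical_sets.
Require Import Defs.
Import GRing.Theory.
Local Open Scope ring_scope.
Local Open Scope classical_set_scope.

(** Fix a prime [Q0] of [R] and take, by Zorn's lemma, a maximal
chain [C] of primes of [R] contained in [Q0]. It turns out that [C] already
meets the fibre of every prime [P] of the valuation ring with [P] contained in
the contraction of [Q0] ([maximal_chain_covers]), which gives GGD at once, for
chains of any cardinality and any order type.

To see this, cut [C] at [P]: the members whose contraction contains [P] are
upper, the others are lower. Let [N] be the union of the zero ideal and the
lower members. A prime [Q] that contains [PR + N] and misses every product
[c r], with [c] outside [P] and [r] outside some upper member, lies over [P] and
sits between the lower and the upper members, so it belongs to [C] by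
maximality. These products form an m-system, and a prime containing a given
ideal and avoiding a disjoint m-system always exists. What remains is that
[PR + N] contains no such product, and here the valuation enters. Because
divisibility is total, every element of [PR] has the form [p s] with [p] in [P],
and every [c] outside [P] divides [p], say [p = c d] with [d] again in [P].
If [c r] is in [p s + N], then [c (r - d s)] is in [N]. Now [c] can be cancelled
modulo [N], by torsion-freeness for the zero ideal and by primeness for the
lower members, as [c] is outside their contractions. Hence [r] is in [d s + N],
which every upper member contains: a contradiction.

For the second assertion it suffices to find a prime [Q0] whose contraction
contains every proper ideal. If [m] is a nonunit of the valuation ring, then it
stays a nonunit in [R], so the nonunits generate a proper ideal of [R], again
because its elements are the products [m s]; any prime above it will do. *)

Set Implicit Arguments.
Unset Strict Implicit.

(** * Zorn's lemma above a given set *)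

(** [Zorn_bigcup] also asks for [P] at the union of the empty chain, which is never
an ideal; starting from a member [A0] of [P] removes that case. *)
Lemma Zorn_bigcup_above (T : Type) (P : set (set T)) (A0 : set T) :
  P A0 ->
  (forall F : set (set T), F `<=` P -> F !=set0 -> total_on F subset ->
     P (\bigcup_(X in F) X)) ->
  exists A, [/\ P A, A0 `<=` A & forall B, P B -> A `<=` B -> B `<=` A].
Proof.
move=> PA0 Pcup; pose P' := [set X | P (A0 `|` X)].
case: (@Zorn_bigcup T P') => [F FP' Ftot|A [P'A Amax]].
  rewrite /P' /=.
  have -> : A0 `|` \bigcup_(X in F) X
      = \bigcup_(Y in A0 |` [set A0 `|` X | X in F]) Y.
    apply/seteqP; split=> x.
    - case=> [A0x|[X FX Xx]]; first by exists A0 => //; left.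
      by exists (A0 `|` X); [right; exists X | right].
    - case=> Y [->|[X FX <-]]; first by left.
      by case=> [|Xx]; [left | right; exists X].
  apply: Pcup.
  - by move=> Y [->//|[X /FP' PX <-]].
  - by exists A0; left.
  - move=> Y Z [->|[X FX <-]] [->|[X' FX' <-]].
    + by left.
    + by left=> x; left.
    + by right=> x; left.
    + by case: (Ftot _ _ FX FX') => XX'; [left|right]; apply: setUS.
exists (A0 `|` A); split=> // B PB AB x Bx.
apply: contrapT => nAx; apply: (Amax B) => [|/=].
  split=> [y Ay|BA]; first by apply: AB; right.
  by apply: nAx; right; apply: BA.
rewrite /P' /=; suff -> : A0 `|` B = B by [].
by apply/setUidPr => y A0y; apply: AB; left.
Qed.

(** * Ideals and m-systems in noncommutative rings *)

Section NoncommutativeIdeals.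
Variable R : pzRingType.
Implicit Types (I J Q S : set R) (x y r : R).

Definition ideal_add I J : set R :=
  [set x | exists i j, [/\ I i, J j & x = i + j]].

Lemma idealD I x y : two_sided_ideal I -> I x -> I y -> I (x + y).
Proof.
move=> idI Ix Iy; rewrite -[y]opprK; apply: idealB => //.
by rewrite -sub0r; apply: idealB => //; apply: ideal0.
Qed.

Lemma ideal_add_ideal I J : two_sided_ideal I -> two_sided_ideal J ->
  two_sided_ideal (ideal_add I J).
Proof.
move=> idI idJ; split.
- by exists 0, 0; rewrite addr0; split=> //; apply: ideal0.
- move=> _ _ [i [j [Ii Jj ->]]] [i' [j' [Ii' Jj' ->]]].
  by exists (i - i'), (j - j'); rewrite opprD addrACA; split=> //; apply: idealB.
- move=> r _ [i [j [Ii Jj ->]]].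
  by exists (r * i), (r * j); rewrite mulrDr; split=> //; apply: idealMl.
- move=> r _ [i [j [Ii Jj ->]]].
  by exists (i * r), (j * r); rewrite mulrDl; split=> //; apply: idealMr.
Qed.

Lemma ideal_addl I J : two_sided_ideal J -> I `<=` ideal_add I J.
Proof. by move=> idJ x Ix; exists x, 0; rewrite addr0; split=> //; apply: ideal0. Qed.

Lemma ideal_addr I J : two_sided_ideal I -> J `<=` ideal_add I J.
Proof. by move=> idI x Jx; exists 0, x; rewrite add0r; split=> //; apply: ideal0. Qed.

Lemma ideal0_ideal : two_sided_ideal [set 0 : R].
Proof.
by split=> //= [x y -> ->|r x ->|r x ->]; rewrite ?subr0 ?mulr0 ?mul0r.
Qed.

Lemma ideal_bigcup_chain (F : set (set R)) : F !=set0 ->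
    (forall I, F I -> two_sided_ideal I) -> total_on F subset ->
  two_sided_ideal (\bigcup_(I in F) I).
Proof.
move=> [I0 FI0] idF Ftot; split.
- by exists I0 => //; apply: (ideal0 (idF _ FI0)).
- move=> x y [I FI Ix] [J FJ Jy]; case: (Ftot _ _ FI FJ) => IJ.
  + by exists J => //; apply: (idealB (idF _ FJ)) => //; apply: IJ.
  + by exists I => //; apply: (idealB (idF _ FI)) => //; apply: IJ.
- by move=> r x [I FI Ix]; exists I => //; apply: (idealMl (idF _ FI)).
- by move=> r x [I FI Ix]; exists I => //; apply: (idealMr (idF _ FI)).
Qed.

Lemma prime_not1 Q : prime_ideal Q -> ~ Q 1.
Proof.
case=> idQ properQ _ Q1; apply: properQ; apply/seteqP; split=> // x _.
by rewrite -[x]mulr1; apply: idealMl.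
Qed.

Definition m_system S : Prop :=
  forall x y, S x -> S y -> exists r, S (x * r * y).

(** If [x R y] is contained in [Q], then the annihilator-like ideals [J] of all
[b] with [x R b] in [Q], and [I] of all [a] with [a R J] in [Q], contain [y] and
[x] respectively and have product in [Q]; using them avoids describing the
elements of the principal ideals [RxR] and [RyR]. *)
Lemma prime_m_system Q : prime_ideal Q -> m_system (~` Q).
Proof.
case=> idQ _ primeQ x y nQx nQy; apply: contrapT => nxRy.
pose J := [set b | forall r, Q (x * r * b)].
pose I := [set a | forall b r, J b -> Q (a * r * b)].
have Jy : J y by move=> r; apply: contrapT => nQ; apply: nxRy; exists r.
have Ix : I x by move=> b r Jb; apply: Jb.
have idJ : two_sided_ideal J.
  split.
  - by move=> r; rewrite mulr0; apply: ideal0.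
  - by move=> b c Jb Jc r; rewrite mulrBr; apply: idealB.
  - by move=> s b Jb r; rewrite mulrA -(mulrA x); apply: Jb.
  - by move=> s b Jb r; rewrite mulrA; apply: idealMr.
have idI : two_sided_ideal I.
  split.
  - by move=> b r _; rewrite !mul0r; apply: ideal0.
  - by move=> a c Ia Ic b r Jb; rewrite !mulrBl; apply: idealB => //; [apply: Ia | apply: Ic].
  - by move=> s a Ia b r Jb; rewrite -!mulrA; apply: idealMl => //; rewrite mulrA; apply: Ia.
  - by move=> s a Ia b r Jb; rewrite -(mulrA a); apply: Ia.
have IJ a b : I a -> J b -> Q (a * b).
  by move=> Ia Jb; rewrite -[a]mulr1; apply: Ia.
by case: (primeQ I J idI idJ IJ) => sub; [apply: nQx; apply: sub | apply: nQy; apply: sub].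
Qed.

(** An ideal maximal among those that contain [I] and miss [S] is prime: two
ideals [J], [K] not inside it reach [S] once it is added, and the m-system
condition then turns [JK] inside it into an element of [S] inside it. *)
Lemma prime_avoiding_m_system I S : two_sided_ideal I -> m_system S -> S !=set0 ->
    (forall x, I x -> ~ S x) ->
  exists Q, [/\ prime_ideal Q, I `<=` Q & forall x, Q x -> ~ S x].
Proof.
move=> idI mS [s0 Ss0] IS.
pose avoiding := [set J | two_sided_ideal J /\ forall x, J x -> ~ S x].
case: (@Zorn_bigcup_above R avoiding I) => //.
  move=> F Fav F0 Ftot; split; first by apply: ideal_bigcup_chain => // J /Fav[].
  by move=> x [J /Fav[_ JS] /JS].
move=> Q [[idQ QS] IQ Qmax]; exists Q; split=> //; split=> //.
  by move=> QT; apply: (QS s0) => //; rewrite QT.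
move=> J K idJ idK JK; apply: contrapT => /not_orP[nJQ nKQ].
have meets L : two_sided_ideal L -> ~ L `<=` Q ->
    exists l q, [/\ L l, Q q & S (l + q)].
  move=> idL nLQ; apply: contrapT => avoids; apply: nLQ.
  apply: (subset_trans (ideal_addl (I := L) idQ)).
  apply: Qmax; last exact: ideal_addr.
  split; first exact: ideal_add_ideal.
  by move=> _ [l [q [Ll Qq ->]]] Slq; apply: avoids; exists l, q.
have [j [q [Jj Qq Sjq]]] := meets J idJ nJQ.
have [k [q' [Kk Qq' Skq]]] := meets K idK nKQ.
have [r] := mS _ _ Sjq Skq; apply: QS.
rewrite mulrDr; apply: idealD => //; last exact: idealMl.
rewrite !mulrDl; apply: idealD => //; last by do 2 apply: idealMr => //.
by apply: JK => //; apply: idealMr.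
Qed.

End NoncommutativeIdeals.

(** * Algebras over a ring with total divisibility *)

(** For an integral domain this characterizes valuation rings. *)
Definition total_divisibility (A : comPzRingType) : Prop :=
  forall a b : A, (exists d, a = b * d) \/ (exists d, b = a * d).

Section TotalDivisibility.
Variables (A : comPzRingType) (R : pzRingType) (phi : {rmorphism A -> R}).
Hypotheses (divA : total_divisibility A) (phi_central : central_morphism phi).
Implicit Types (M P : set A) (Q : set R) (C : set (set R)).

Lemma primeM P c d : prime_ideal P -> P (c * d) -> ~ P c -> P d.
Proof.
move=> prP Pcd nPc; apply: contrapT => nPd.
have [r] := prime_m_system prP nPc nPd; apply.
by rewrite mulrAC; case: prP => idP _ _; apply: idealMr.
Qed.

Definition extension M : set R :=
  [set x | exists m s, M m /\ x = phi m * s].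

(** No sums are needed: of two elements of [M] one divides the other, so a
difference of two multiples is a multiple of the divisor. The two uses are for
a prime [M] and for the set of nonunits. *)
Lemma extension_ideal M : M !=set0 -> two_sided_ideal (extension M).
Proof.
move=> [m0 Mm0]; split.
- by exists m0, 0; rewrite mulr0.
- move=> _ _ [m [s [Mm ->]]] [n [t [Mn ->]]].
  case: (divA m n) => -[d e]; rewrite e rmorphM -mulrA -mulrBr.
  + by exists n, (phi d * s - t).
  + by exists m, (s - phi d * t).
- move=> r _ [m [s [Mm ->]]]; exists m, (r * s); split=> //.
  by rewrite !mulrA phi_central.
- by move=> r _ [m [s [Mm ->]]]; exists m, (s * r); rewrite mulrA.
Qed.

Lemma extension_sub M Q : two_sided_ideal Q ->
  M `<=` phi @^-1` Q -> extension M `<=` Q.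
Proof. by move=> idQ MQ _ [m [s [/MQ Qm ->]]]; apply: idealMr. Qed.

Lemma sub_extension M : M `<=` phi @^-1` extension M.
Proof. by move=> m Mm; exists m, 1; rewrite mulr1. Qed.

Lemma outside_prime_dvd P c p : two_sided_ideal P -> P p -> ~ P c ->
  exists d, p = c * d.
Proof.
move=> idP Pp nPc; case: (divA p c) => // -[d cpd].
by case: nPc; rewrite cpd; apply: idealMr.
Qed.

Lemma prime_scalar_cancel Q c s : prime_ideal Q ->
  Q (phi c * s) -> ~ Q (phi c) -> Q s.
Proof.
move=> prQ Qcs nQc; apply: contrapT => nQs.
have [r] := prime_m_system prQ nQc nQs; apply.
by rewrite (phi_central c r) -mulrA; case: prQ => idQ _ _; apply: idealMl.
Qed.

(** The role of [N] is to keep [Q] above a given part of a chain, and that of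
the family [U] to keep it below the rest. Products of elements outside [P] and
outside a member of [U] form an m-system because the members of [U] are
comparable, so that two elements can be tested against the same one. *)
Lemma prime_between (P : set A) (N : set R) (U : set (set R)) :
    prime_ideal P -> two_sided_ideal N ->
    (forall c s, ~ P c -> N (phi c * s) -> N s) ->
    prime_chain U -> U !=set0 ->
    (forall Q, U Q -> N `<=` Q /\ P `<=` phi @^-1` Q) ->
  exists Q, [/\ prime_ideal Q, lying_over phi Q P, N `<=` Q
              & forall Q', U Q' -> Q `<=` Q'].
Proof.
move=> prP idN Ncancel [Uprime Uchain] [Q1 UQ1] Uabove.
have idP : two_sided_ideal P by case: prP.
have nP1 := prime_not1 prP.
have idPR : two_sided_ideal (extension P).
  by apply: extension_ideal; exists 0; apply: ideal0.
pose outside := [set r | exists2 Q, U Q & ~ Q r].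
pose S := [set x | exists c r, [/\ ~ P c, outside r & x = phi c * r]].
have Sout r : outside r -> S r by exists 1, r; rewrite rmorph1 mul1r.
have Sphi c : ~ P c -> S (phi c).
  move=> nPc; exists c, 1; rewrite mulr1; split=> //.
  by exists Q1 => //; apply: prime_not1; apply: Uprime.
have mout r s : outside r -> outside s -> exists t, outside (r * t * s).
  move=> [Q UQ nQr] [Q' UQ' nQs].
  have [Q'' UQ'' [nQr'' nQs'']] : exists2 Q'', U Q'' & ~ Q'' r /\ ~ Q'' s.
    by case: (Uchain _ _ UQ UQ') => QQ'; [exists Q | exists Q'] => //; split=> // /QQ'.
  have [t nQt] := prime_m_system (Uprime _ UQ'') nQr'' nQs''.
  by exists t, Q''.
have mS : m_system S.
  move=> _ _ [c [r [nPc outr ->]]] [d [s [nPd outs ->]]].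
  have [t outt] := mout _ _ outr outs.
  exists t, (c * d), (r * t * s); split=> //.
    by move=> Pcd; apply: nPd; apply: primeM Pcd nPc.
  rewrite rmorphM -!mulrA; congr (_ * _).
  by rewrite (mulrA t) -(phi_central d t) !mulrA -(phi_central d r).
have disjoint x : ideal_add (extension P) N x -> ~ S x.
  move=> [_ [n [[p [s [Pp ->]]] Nn ->]]] [c [r [nPc [Q UQ nQr] E]]].
  have [NQ PQ] := Uabove Q UQ; have [idQ _ _] := Uprime Q UQ.
  have [d pcd] := outside_prime_dvd idP Pp nPc.
  have Pd : P d by apply: (primeM (c := c)) => //; rewrite -pcd.
  have Nrds : N (r - phi d * s).
    apply: (Ncancel c) => //.
    by rewrite mulrBr -E pcd rmorphM -mulrA addrC addKr.
  apply: nQr; rewrite -(subrK (phi d * s) r); apply: idealD => //.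
    exact: NQ.
  by apply: idealMr => //; apply: PQ.
have S0 : S !=set0 by exists (phi 1); apply: Sphi.
have [Q [prQ IQ QS]] :=
  prime_avoiding_m_system (ideal_add_ideal idPR idN) mS S0 disjoint.
exists Q; split=> //.
- apply/seteqP; split=> c.
    by move=> Pc; apply: IQ; apply: ideal_addl => //; apply: sub_extension.
  by move=> Qc; apply: contrapT => /Sphi; apply: QS.
- by apply: (subset_trans _ IQ); apply: ideal_addr.
- move=> Q' UQ' x Qx; apply: contrapT => nQ'x.
  by apply: (QS x) => //; apply: Sout; exists Q'.
Qed.

Hypothesis R_torsion_free : torsion_free phi.

Definition chain_below Q0 : set (set (set R)) :=
  [set C | prime_chain C /\ forall Q, C Q -> Q `<=` Q0].

Lemma maximal_chain_below Q0 : exists C, chain_below Q0 C /\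
  forall B, chain_below Q0 B -> C `<=` B -> B `<=` C.
Proof.
case: (@Zorn_bigcup_above _ (chain_below Q0) set0) => [| |C [CQ0 _ Cmax]].
- by split=> //; split=> [Q|Q].
- move=> F FQ0 _ Ftot; split; first split.
  + by move=> Q [C /FQ0[[Cprime _] _] /Cprime].
  + move=> Q Q' [C FC CQ] [C' FC' CQ'].
    case: (Ftot _ _ FC FC') => CC'.
      by case: (FQ0 _ FC') => -[_ chC] _; apply: chC => //; apply: CC'.
    by case: (FQ0 _ FC) => -[_ chC] _; apply: chC => //; apply: CC'.
  + by move=> Q [C /FQ0[_ below] /below].
- by exists C.
Qed.

Lemma maximal_chain_mem Q0 C Q :
    chain_below Q0 C -> (forall B, chain_below Q0 B -> C `<=` B -> B `<=` C) ->
    prime_ideal Q -> Q `<=` Q0 ->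
    (forall Q', C Q' -> Q' `<=` Q \/ Q `<=` Q') ->
  C Q.
Proof.
move=> [[Cprime Cchain] CQ0] Cmax prQ QQ0 cmpQ.
apply: (Cmax (Q |` C)); [|by move=> Q'; right|by left].
split; first split.
- by move=> Q' [->|/Cprime].
- move=> Q1 Q2 [->|CQ1] [->|CQ2].
  + by left.
  + by case: (cmpQ _ CQ2); [right|left].
  + exact: cmpQ.
  + exact: Cchain.
- by move=> Q' [->|/CQ0].
Qed.

(** A prime [P] cuts a maximal chain into the members whose contraction contains
[P] and the others, and [prime_between] finds a prime over [P] that fits into
the cut. By maximality the chain contains it already. *)
Lemma maximal_chain_covers Q0 : prime_ideal Q0 ->
  exists C, [/\ prime_chain C, final_element C Q0 &
    forall P, prime_ideal P -> P `<=` phi @^-1` Q0 ->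
      exists2 Q, C Q & lying_over phi Q P].
Proof.
move=> prQ0; have [C [CQ0 Cmax]] := maximal_chain_below Q0.
have [Cprimechain belowQ0] := CQ0; have [Cprime Cchain] := Cprimechain.
have memQ0 : C Q0.
  by apply: maximal_chain_mem CQ0 Cmax prQ0 _ _ => // Q /belowQ0; left.
exists C; split=> // P prP PQ0.
have idP : two_sided_ideal P by case: prP.
pose U := [set Q | C Q /\ P `<=` phi @^-1` Q].
pose L := [set Q | C Q /\ ~ P `<=` phi @^-1` Q].
(* the zero ideal covers the case of an empty lower part *)
pose N := \bigcup_(Q in [set 0] |` L) Q.
have L_sub_U Q Q' : L Q -> U Q' -> Q `<=` Q'.
  move=> [CQ nPQ] [CQ' PQ']; case: (Cchain _ _ CQ CQ') => // Q'Q.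
  by case: nPQ => p /PQ' /Q'Q.
have zero_sub Q : C Q -> [set 0] `<=` Q.
  by move=> /Cprime[idQ _ _] _ ->; apply: ideal0.
have idN : two_sided_ideal N.
  apply: ideal_bigcup_chain.
  - by exists [set 0]; left.
  - by move=> Q [->|[/Cprime[]]] //; apply: ideal0_ideal.
  - move=> Q Q' [->|[CQ _]] [->|[CQ' _]].
    + by left.
    + by left; apply: zero_sub.
    + by right; apply: zero_sub.
    + exact: Cchain.
have Ncancel c s : ~ P c -> N (phi c * s) -> N s.
  move=> nPc [Q [->|LQ] Qcs].
    exists [set 0]; first by left.
    case: (R_torsion_free Qcs) => // c0.
    by case: nPc; rewrite c0; apply: ideal0.
  exists Q; first by right.
  case: LQ => /Cprime prQ nPQ; apply: prime_scalar_cancel Qcs _ => // Qc.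
  apply: nPQ => p Pp; have [d ->] := outside_prime_dvd idP Pp nPc.
  by case: prQ => idQ _ _; rewrite /= rmorphM; apply: idealMr.
have Uprimechain : prime_chain U.
  by split=> [Q [/Cprime]|Q Q' [CQ _] [CQ' _]] //; apply: Cchain.
have U0 : U Q0 by split.
case: (prime_between prP idN Ncancel Uprimechain).
- by exists Q0.
- move=> Q UQ; split; last by case: UQ.
  move=> x [Q' [->|LQ'] Q'x]; first by apply: zero_sub Q'x; case: UQ.
  exact: L_sub_U UQ _ Q'x.
move=> Q [prQ overP NQ QU]; exists Q => //.
apply: maximal_chain_mem CQ0 Cmax prQ _ _; first exact: QU.
move=> Q' CQ'; have [PQ'|nPQ'] := pselect (P `<=` phi @^-1` Q').
  by right; apply: QU.
by left=> x Q'x; apply: NQ; exists Q' => //; right.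
Qed.

Lemma ggd_total_divisibility : GGD phi.
Proof.
move=> D P0 Q0 [Dprime _] [_ DP0] prQ0 overP0.
have [C [Cprimechain Cfinal Ccover]] := maximal_chain_covers prQ0.
exists C; split=> // P DP; apply: Ccover; first exact: Dprime.
by rewrite -overP0; apply: DP0.
Qed.

(** The nonunits generate a proper ideal of [R]: an equation [m s = 1] would make
the nonunit [m] invertible in [R]. A prime above that ideal is therefore a
common bound for all primes of [A]. *)
Lemma exists_prime_above_nonunits : ~ units A 0 ->
    phi @^-1` units R `<=` units A ->
  exists2 Q0, prime_ideal Q0 & ~` units A `<=` phi @^-1` Q0.
Proof.
move=> n0 unitsA.
have idM : two_sided_ideal (extension (~` units A)).
  by apply: extension_ideal; exists 0.
case: (@prime_avoiding_m_system R _ [set 1] idM).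
- by move=> x y -> ->; exists 1; rewrite !mulr1.
- by exists 1.
- move=> _ [m [s [num ->]]] ms1; apply/num/unitsA; exists s.
  by split; last rewrite -phi_central.
move=> Q0 [prQ0 MQ0 _]; exists Q0 => // m num.
by apply: MQ0; apply: sub_extension.
Qed.

Lemma prime_sub_nonunits P : prime_ideal P -> P `<=` ~` units A.
Proof.
move=> prP p Pp [q [pq1 _]]; apply: (prime_not1 prP); rewrite -pq1.
by case: prP => idP _ _; apply: idealMr.
Qed.

End TotalDivisibility.

(** * The valuation ring *)

(** For nonzero [x] and [y] the values of [x / y] and [y / x] add up to zero, so
one of the two quotients lies in the valuation ring. *)
Lemma valring_total_divisibility (F : fieldType) (G : orderedGroupType)
  (v : valuation F G) : total_divisibility (valring v).
Proof.
move=> a b; case: (eqVneq (val b) 0) => [b0|b0].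
  by right; exists 0; apply: val_inj; rewrite mulr0 b0 rmorph0.
case: (eqVneq (val a) 0) => [a0|a0].
  by left; exists 0; apply: val_inj; rewrite mulr0 a0 rmorph0.
pose x := val a / val b; pose y := val b / val a.
have xy1 : x * y = 1 by rewrite /x /y mulrA divfK ?divff.
have [xv|yv] : x \in in_valring v \/ y \in in_valring v.
  have := valuationM v x y; rewrite xy1 valuation1 !unfold_in /in_valring.
  case: (v x) (v y) => [g|] [h|] //= [gh0].
  case/orP: (ogroup_total 0 g) => [g0|g0]; first by left.
  by right; have := ogroup_leD2l h g0; rewrite addr0 (addrC h) -gh0.
- left; exists (Valring xv); apply: val_inj.
  by rewrite rmorphM /= /x mulrC divfK.
- right; exists (Valring yv); apply: val_inj.
  by rewrite rmorphM /= /y mulrC divfK.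
Qed.

Theorem corollary3p8 (F : fieldType) (G : orderedGroupType)
  (v : valuation F G) (v_nontrivial : nontrivial_valuation v)
  (R : pzRingType) (phi : {rmorphism valring v -> R})
  (phi_central : central_morphism phi) (R_torsion_free : torsion_free phi) :
  GGD phi /\
  (phi @^-1` units R `<=` units (valring v) ->
   forall D : set (set (valring v)), prime_chain D ->
   exists2 C : set (set R), prime_chain C & covers phi C D).
Proof.
have divA := @valring_total_divisibility F G v.
split; first exact: ggd_total_divisibility.
move=> unitsA D [Dprime _].
have n0 : ~ units (valring v) 0.
  by move=> [y [/eqP]]; rewrite mul0r eq_sym oner_eq0.
have [Q0 prQ0 nuQ0] := exists_prime_above_nonunits divA phi_central n0 unitsA.
have [C [Cprimechain _ Ccover]] :=
  maximal_chain_covers divA phi_central R_torsion_free prQ0.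
exists C => // P /Dprime prP; apply: Ccover => //.
by apply: subset_trans nuQ0; apply: prime_sub_nonunits.
Qed.
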